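(* Let $\varepsilon$ be an equation in a signature $\Sigma$ and let $\mathcal X$ be the class of all algebras in the signature $\Sigma$. Then the propagating core $$\mathcal X_{[\varepsilon]}=\{X\in\mathcal X:\varepsilon\text{ propagates in }X\}$$ is a quasivariety.
   Context: An equation $\varepsilon=\varepsilon(x_1,\dots,x_n)$ with $n$ variables in the signature of an algebra $X$ propagates in $X$ if for all $x_1,\dots,x_n\in X$: if $\varepsilon(x_1,\dots,x_n)$ holds, then $\varepsilon(y_1,\dots,y_n)$ holds for all $y_1,\dots,y_n$ in the subalgebra $\langle x_1,\dots,x_n\rangle$ of $X$ generated by $x_1,\dots,x_n$. A quasivariety is a class of algebras of a fixed signature axiomatized by a set of quasi-identities (universally quantified implications from a finite conjunction of equations to an equation). *)

(* Defs.v *)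
From Stdlib Require List.
From mathcomp Require Import all_boot.

Set Implicit Arguments.
Unset Strict Implicit.
Unset Printing Implicit Defensive.

Record signature := Signature {
  op : Type;
  arity : op -> nat
}.

(* [carrier ^ k] is [{ffun 'I_k -> carrier}], so tuples of arguments are
   extensional without any axiom. The carrier may be empty. *)
Record algebra (Sig : signature) := Algebra {
  carrier :> Type;
  interp : forall f : op Sig, carrier ^ (arity f) -> carrier
}.

Inductive term (Sig : signature) (n : nat) : Type :=
| Var of 'I_n
| App (f : op Sig) of (term Sig n) ^ (arity f).

Fixpoint eval (Sig : signature) (X : algebra Sig) (n : nat) (v : X ^ n)
    (t : term Sig n) : X :=
  match t with
  | Var i => v i
  | App f args => interp [ffun i => eval v (args i)]
  end.

Record equation (Sig : signature) (n : nat) := Equation {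
  lhs : term Sig n;
  rhs : term Sig n
}.

Definition holds (Sig : signature) (X : algebra Sig) (n : nat)
    (e : equation Sig n) (v : X ^ n) : Prop :=
  eval v (lhs e) = eval v (rhs e).

Definition is_subalgebra (Sig : signature) (X : algebra Sig)
    (S : X -> Prop) : Prop :=
  forall (f : op Sig) (args : X ^ (arity f)),
    (forall i, S (args i)) -> S (interp args).

Definition generated_subalgebra (Sig : signature) (X : algebra Sig) (n : nat)
    (x : X ^ n) (y : X) : Prop :=
  forall S : X -> Prop, is_subalgebra S -> (forall i, S (x i)) -> S y.

Definition propagates (Sig : signature) (n : nat) (e : equation Sig n)
    (X : algebra Sig) : Prop :=
  forall x : X ^ n, holds e x ->
  forall y : X ^ n, (forall i, generated_subalgebra x (y i)) -> holds e y.

Definition algebra_class (Sig : signature) := algebra Sig -> Prop.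

Definition all_algebras (Sig : signature) : algebra_class Sig :=
  fun=> True.

Definition propagating_core (Sig : signature) (K : algebra_class Sig)
    (n : nat) (e : equation Sig n) : algebra_class Sig :=
  fun X => K X /\ propagates e X.

Record quasi_identity (Sig : signature) := QuasiIdentity {
  qvars : nat;
  premises : seq (equation Sig qvars);
  conclusion : equation Sig qvars
}.

Definition satisfies (Sig : signature) (X : algebra Sig)
    (q : quasi_identity Sig) : Prop :=
  forall v : X ^ (qvars q),
    List.Forall (fun e => holds e v) (premises q) -> holds (conclusion q) v.

Definition quasivariety (Sig : signature) (K : algebra_class Sig) : Prop :=
  exists Q : quasi_identity Sig -> Prop,
    forall X : algebra Sig, K X <-> (forall q, Q q -> satisfies X q).

(* Main.v *)
Require Import Defs.
From mathcomp Require Import all_boot.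

(** The elements of the subalgebra generated by [x] are exactly the values at
    [x] of terms in [n] variables. Hence [eps] propagates in [X] if and only if
    [X] satisfies, for every [n]-tuple of terms [t], the quasi-identity
    [eps(x) -> eps(t(x))]. *)

(* The automatically generated [term_ind] has no hypothesis for the subterms
   nested in the finite function of arguments. *)
Fixpoint term_nested_ind (Sig : signature) (n : nat) (P : term Sig n -> Prop)
    (PVar : forall i, P (Var Sig i))
    (PApp : forall f (args : term Sig n ^ arity f),
      (forall i, P (args i)) -> P (App args))
    (t : term Sig n) : P t :=
  match t with
  | Var i => PVar i
  | App f args =>
      PApp f args (fun i => term_nested_ind Sig n P PVar PApp (args i))
  end.

Fixpoint subst (Sig : signature) (n m : nat) (s : 'I_n -> term Sig m)
    (t : term Sig n) : term Sig m :=
  match t with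
  | Var i => s i
  | App f args => App [ffun i => subst Sig n m s (args i)]
  end.
Arguments subst {Sig n m}.

Definition subst_equation {Sig : signature} {n m : nat}
    (s : 'I_n -> term Sig m) (e : equation Sig n) : equation Sig m :=
  Equation (subst s (lhs e)) (subst s (rhs e)).

Lemma eval_subst (Sig : signature) (X : algebra Sig) (n m : nat)
    (s : 'I_n -> term Sig m) (v : X ^ m) (t : term Sig n) :
  eval v (subst s t) = eval [ffun i => eval v (s i)] t.
Proof.
elim/term_nested_ind: t => [i|f args IH] /=; first by rewrite ffunE.
by congr interp; apply/ffunP => i; rewrite !ffunE IH.
Qed.

(** Links the conclusion of a quasi-identity, a substituted equation, to [e] at a tuple of term
    values, the form propagation speaks of. *)
Lemma holds_subst (Sig : signature) (X : algebra Sig) (n m : nat)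
    (s : 'I_n -> term Sig m) (v : X ^ m) (e : equation Sig n) :
  holds (subst_equation s e) v <-> holds e [ffun i => eval v (s i)].
Proof. by rewrite /holds /= !eval_subst. Qed.

(** Term values at [x] form a subalgebra containing each [x i]; conversely, by induction on terms,
    every such subalgebra contains them. *)
Lemma generated_subalgebraP (Sig : signature) (X : algebra Sig) (n : nat)
    (x : X ^ n) (y : X) :
  generated_subalgebra x y <-> exists t : term Sig n, eval x t = y.
Proof.
split=> [gen_y | [t <-] S subS Sx].
  apply: (gen_y (fun z => exists t, eval x t = z)) => [f args|i]; last by exists (Var Sig i).
  (* The arity is finite, so one term per argument can be chosen without an axiom. *)
  case/fin_all_exists=> t evt; exists (App [ffun i => t i]) => /=.
  by congr interp; apply/ffunP => i; rewrite !ffunE.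
elim/term_nested_ind: t => [i|f args IH] //=.
by apply: subS => i; rewrite ffunE.
Qed.

Theorem theorem1p2 (Sig : signature) (n : nat) (eps : equation Sig n) :
  quasivariety (propagating_core (@all_algebras Sig) eps).
Proof.
exists (fun q => exists t : 'I_n -> term Sig n,
  q = QuasiIdentity [:: eps] (subst_equation t eps)) => X.
split=> [[_ prop_eps] _ [t ->] v /= prems | satX].
  apply/holds_subst; apply: (prop_eps _ (List.Forall_inv prems)) => i.
  by apply/generated_subalgebraP; exists (t i); rewrite ffunE.
split=> // x eps_x y gen_y.
(* Choosing a term for each [y i] selects the quasi-identity to apply at [x]. *)
have /fin_all_exists [t evt] i : exists t, eval x t = y i.
  exact/generated_subalgebraP.
have -> : y = [ffun i => eval x (t i)] by apply/ffunP => i; rewrite ffunE.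
apply/holds_subst.
have sat_t := satX (QuasiIdentity [:: eps] (subst_equation t eps)).
apply: sat_t; first by exists t.
by apply: List.Forall_cons.
Qed.
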